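(* Let $\mathcal{D}$ be the set of all Condorcet domains in $W$ and $\mathcal{P}$ the set of all Condorcet root posets on $\Phi$. The closed Condorcet domains are precisely the elements of the image $\psi(\mathcal{P})$, and they are in bijection with $\mathcal{P}$ under $\varphi$ with inverse $\psi$. Moreover, for $D_1,D_2\in\mathcal{D}$, $\varphi(D_1)=\varphi(D_2)$ if and only if $\overline{D}_1=\overline{D}_2$.
   Context: Let $\Phi$ be a finite root system in a real Euclidean space (a finite set of nonzero vectors with $\Phi\cap\mathbb{R}\alpha=\{\alpha,-\alpha\}$ and $s_\alpha(\Phi)=\Phi$ for all $\alpha\in\Phi$, where $s_\alpha$ is the orthogonal reflection in $\alpha^\perp$; not necessarily crystallographic). Let $\Phi^+$ be a choice of positive roots, $\Phi^-=\Phi\setminus\Phi^+$, and let $W=W(\Phi)$ be the finite Coxeter group generated by the $s_\alpha$. For $w\in W$, the (left) inversion set is $I(w):=\{\alpha\in\Phi\mid w^{-1}\alpha\in\Phi^-\}$ (negative roots are allowed, so exactly one of $\alpha,-\alpha$ lies in $I(w)$). A set of three roots $\{\alpha,\beta,\gamma\}\subseteq\Phi$ is a root-triple if there exist real $a,b,c>0$ with $a\alpha+b\beta+c\gamma=0$. A nonempty subset $D\subseteq W$ is a Condorcet domain if there do not exist distinct $u,v,w\in D$ and a root-triple $\{\alpha,\beta,\gamma\}$ such that $\alpha,\beta\in I(u)$, $\alpha,\gamma\in I(v)$, $\beta,\gamma\in I(w)$. A voting profile on $D$ is a map $f:D\to\mathbb{Z}_{\ge0}$, not constantly zero. Put $f(\alpha)=\sum_{w\in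 D,\ \alpha\in I(w)}f(w)$ for $\alpha\in\Phi$, $|f|=\sum_{w\in D}f(w)$, $I(f)=\{\alpha\in\Phi\mid f(\alpha)\ge|f|/2\}$ and $R(f)=\{w\in W\mid I(w)\subseteq I(f)\}$. $f$ has no tie if $f(\alpha)\ne|f|/2$ for all $\alpha\in\Phi$. Let $\nu(D)=\bigcup_f R(f)$ over all voting profiles $f$ on $D$ with no tie. A Condorcet domain $D$ is closed if $\nu(D)=D$ (equivalently $\nu(D)\subseteq D$). The closure $\overline{D}$ of a Condorcet domain $D$ is the smallest closed Condorcet domain containing $D$ (the intersection of all closed Condorcet domains containing $D$). ''Poset'' means preposet: a reflexive transitive relation $\le$, not necessarily antisymmetric; $x=y$ in $P$ means $x\le y$ and $y\le x$; $x<y$ means $x\le y$ and not $y\le x$. A preposet $P$ on the set $\Phi$ is an antipodal root poset if (1) for all $\alpha,\beta\in\Phi$, $\alpha\le\beta$ implies $-\beta\le-\alpha$; (2) for all $\gamma\in\Phi$, $\gamma\neq-\gamma$ in $P$, and if $\gamma<-\gamma$ then $\gamma$ is a minimum element of $P$ (i.e. $\gamma\le\delta$ for all $\delta$; there may be several, all equal in $P$). It is a Condorcet root poset if moreover (3) for every root-triple there is a labelling $\{\alpha,\beta,\gamma\}$ of its elements such that in $P$ either $\alpha\ge-\gamma\ge\beta$ or $\alpha=-\gamma$. An order ideal is a down-closed subset; $J_s(P)$ is the set of symmetric order ideals of $P$, i.e. order ideals $I$ with $I\sqcup -I=\Phi$ (disjoint union), where $-I=\{-\alpha\mid\alpha\in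 I\}$. For nonempty $D\subseteq W$ and $\gamma\in\Phi$ let $D(\gamma)=\{v\in D\mid\gamma\in I(v)\}$; $\varphi(D)$ is the preposet on $\Phi$ with $\alpha\le\beta$ if and only if $D(\alpha)\supseteq D(\beta)$ (it is a Condorcet root poset when $D$ is a Condorcet domain). For $P\in\mathcal{P}$, $\psi(P)=\{w\in W\mid I(w)\in J_s(P)\}$ (it is a Condorcet domain). *)

(* Defs.v *)
From mathcomp Require Import all_boot all_order all_algebra.
From mathcomp Require Import all_classical reals.

Set Implicit Arguments.
Unset Strict Implicit.
Unset Printing Implicit Defensive.
Import Order.TTheory GRing.Theory Num.Theory.
Local Open Scope classical_set_scope.
Local Open Scope ring_scope.

(* The Euclidean space is R^n, made of column vectors, with the standard inner
   product; linear maps are n x n matrices acting on the left. *)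
Definition dot (R : realType) (n : nat) (u v : 'cV[R]_n) : R :=
  \sum_(i < n) u i 0 * v i 0.

Definition reflection (R : realType) (n : nat) (a : 'cV[R]_n) : 'M[R]_n :=
  1%:M - (2 / dot a a) *: (a *m a^T).

Lemma reflectionE (R : realType) (n : nat) (a v : 'cV[R]_n) :
  reflection a *m v = v - (2 * dot a v / dot a a) *: a.
Proof.
rewrite /reflection mulmxBl mul1mx -scalemxAl -mulmxA.
have -> : a^T *m v = (dot a v)%:M.
  apply/matrixP => i j; rewrite !ord1 !mxE eqxx mulr1n.
  by apply: eq_bigr => k _; rewrite mxE.
by rewrite mul_mx_scalar scalerA mulrAC.
Qed.

Definition root_system (R : realType) (n : nat) (Phi : set 'cV[R]_n) : Prop :=
  [/\ finite_set Phi,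
      forall a, Phi a -> a != 0,
      forall a, Phi a ->
        Phi `&` [set c *: a | c in [set: R]] = [set a; - a] &
      forall a, Phi a -> [set reflection a *m b | b in Phi] = Phi].

(* Pos is the set of roots on the positive side of a hyperplane that contains
   no root. *)
Definition positive_roots (R : realType) (n : nat)
    (Phi Pos : set 'cV[R]_n) : Prop :=
  exists t : 'cV[R]_n,
    (forall a, Phi a -> dot t a != 0) /\
    Pos = [set a | Phi a /\ 0 < dot t a].

Inductive weyl_group (R : realType) (n : nat) (Phi : set 'cV[R]_n) :
    set 'M[R]_n :=
| weyl_reflection a : Phi a -> weyl_group Phi (reflection a)
| weyl_one : weyl_group Phi 1%:M
| weyl_mul u v :
    weyl_group Phi u -> weyl_group Phi v -> weyl_group Phi (u *m v)
| weyl_inv u : weyl_group Phi u -> weyl_group Phi (invmx u).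

Definition inversion_set (R : realType) (n : nat) (Phi Pos : set 'cV[R]_n)
    (w : 'M[R]_n) : set 'cV[R]_n :=
  [set a | Phi a /\ (Phi `\` Pos) (invmx w *m a)].

Definition root_triple (R : realType) (n : nat) (Phi : set 'cV[R]_n)
    (a b c : 'cV[R]_n) : Prop :=
  [/\ Phi a, Phi b, Phi c, [/\ a != b, a != c & b != c] &
      exists x y z : R,
        [/\ 0 < x, 0 < y, 0 < z & x *: a + y *: b + z *: c = 0]].

Definition condorcet_domain (R : realType) (n : nat) (Phi Pos : set 'cV[R]_n)
    (D : set 'M[R]_n) : Prop :=
  let I := inversion_set Phi Pos in
  [/\ D `<=` weyl_group Phi, D !=set0 &
      ~ exists u v w a b c,
        [/\ [/\ D u, D v & D w], [/\ u != v, u != w & v != w],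
            root_triple Phi a b c &
            [/\ I u a /\ I u b, I v a /\ I v c & I w b /\ I w c]]].

(* A voting profile on D is given by a function on all matrices, of which only
   the values on D matter. *)
Definition voting_profile (R : realType) (n : nat) (D : set 'M[R]_n)
    (f : 'M[R]_n -> nat) : Prop :=
  exists2 w, D w & f w != 0%N.

(* These two are the vote counts f(a) and |f|. Sums over \in are finitely
   supported sums; the reflection group is finite, so for D contained in it
   they are the genuine sums. *)
Definition votes_for (R : realType) (n : nat) (Phi Pos : set 'cV[R]_n)
    (D : set 'M[R]_n) (f : 'M[R]_n -> nat) (a : 'cV[R]_n) : R :=
  \sum_(w \in D `&` [set w | inversion_set Phi Pos w a]) ((f w)%:R : R).

Definition total_votes (R : realType) (n : nat) (D : set 'M[R]_n)
    (f : 'M[R]_n -> nat) : R :=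
  \sum_(w \in D) ((f w)%:R : R).

Definition majority_roots (R : realType) (n : nat) (Phi Pos : set 'cV[R]_n)
    (D : set 'M[R]_n) (f : 'M[R]_n -> nat) : set 'cV[R]_n :=
  [set a | Phi a /\ total_votes D f / 2 <= votes_for Phi Pos D f a].

Definition majority_results (R : realType) (n : nat) (Phi Pos : set 'cV[R]_n)
    (D : set 'M[R]_n) (f : 'M[R]_n -> nat) : set 'M[R]_n :=
  [set w | weyl_group Phi w /\
           inversion_set Phi Pos w `<=` majority_roots Phi Pos D f].

Definition no_tie (R : realType) (n : nat) (Phi Pos : set 'cV[R]_n)
    (D : set 'M[R]_n) (f : 'M[R]_n -> nat) : Prop :=
  forall a, Phi a -> votes_for Phi Pos D f a != total_votes D f / 2.

Definition nu (R : realType) (n : nat) (Phi Pos : set 'cV[R]_n)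
    (D : set 'M[R]_n) : set 'M[R]_n :=
  \bigcup_(f in [set f | voting_profile D f /\ no_tie Phi Pos D f])
    majority_results Phi Pos D f.

Definition closed_condorcet_domain (R : realType) (n : nat)
    (Phi Pos : set 'cV[R]_n) (D : set 'M[R]_n) : Prop :=
  condorcet_domain Phi Pos D /\ nu Phi Pos D = D.

Definition condorcet_closure (R : realType) (n : nat)
    (Phi Pos : set 'cV[R]_n) (D : set 'M[R]_n) : set 'M[R]_n :=
  smallest (closed_condorcet_domain Phi Pos) D.

(* A preposet on Phi is a relation on the whole space that only relates
   elements of Phi, so that equal preposets are equal as relations. *)
Definition preposet (R : realType) (n : nat) (Phi : set 'cV[R]_n)
    (le : 'cV[R]_n -> 'cV[R]_n -> Prop) : Prop :=
  [/\ forall a b, le a b -> Phi a /\ Phi b,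
      forall a, Phi a -> le a a &
      forall a b c, le a b -> le b c -> le a c].

Definition antipodal_root_poset (R : realType) (n : nat) (Phi : set 'cV[R]_n)
    (le : 'cV[R]_n -> 'cV[R]_n -> Prop) : Prop :=
  [/\ preposet Phi le,
      forall a b, Phi a -> Phi b -> le a b -> le (- b) (- a) &
      forall c, Phi c ->
        ~ (le c (- c) /\ le (- c) c) /\
        (le c (- c) /\ ~ le (- c) c -> forall d, Phi d -> le c d)].

Definition condorcet_root_poset (R : realType) (n : nat) (Phi : set 'cV[R]_n)
    (le : 'cV[R]_n -> 'cV[R]_n -> Prop) : Prop :=
  antipodal_root_poset Phi le /\
  forall a' b' c', root_triple Phi a' b' c' ->
    exists a b c, perm_eq [:: a; b; c] [:: a'; b'; c'] /\
      ((le (- c) a /\ le b (- c)) \/ (le a (- c) /\ le (- c) a)).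

Definition order_ideal (R : realType) (n : nat) (Phi : set 'cV[R]_n)
    (le : 'cV[R]_n -> 'cV[R]_n -> Prop) (I : set 'cV[R]_n) : Prop :=
  I `<=` Phi /\ forall a b, I b -> le a b -> I a.

Definition symmetric_ideals (R : realType) (n : nat) (Phi : set 'cV[R]_n)
    (le : 'cV[R]_n -> 'cV[R]_n -> Prop) : set (set 'cV[R]_n) :=
  [set I | [/\ order_ideal Phi le I,
               I `|` [set - a | a in I] = Phi &
               I `&` [set - a | a in I] = set0]].

Definition phi (R : realType) (n : nat) (Phi Pos : set 'cV[R]_n)
    (D : set 'M[R]_n) : 'cV[R]_n -> 'cV[R]_n -> Prop :=
  let D_ c := [set v | D v /\ inversion_set Phi Pos v c] in
  fun a b => [/\ Phi a, Phi b & D_ b `<=` D_ a].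

Definition psi (R : realType) (n : nat) (Phi Pos : set 'cV[R]_n)
    (le : 'cV[R]_n -> 'cV[R]_n -> Prop) : set 'M[R]_n :=
  [set w | weyl_group Phi w /\
           symmetric_ideals Phi le (inversion_set Phi Pos w)].

(* Main.v *)
Require Import Defs.
From mathcomp Require Import all_boot all_order all_algebra.
From mathcomp Require Import all_classical reals.
From mathcomp Require Import zify lra.

(** Two finite facts carry the correspondence, one about root systems and one
    about majorities.

    The first identifies inversion sets with the tournaments on the roots (one
    root from each pair a, - a) that contain no root-triple
    ([tournament_inversion]). Reflecting such a tournament in one of its positive
    members a lowers the number of its positive members: if b' is the image of b
    under the reflection and b is positive while b' is negative, then a, - b, b'
    is a root-triple. So a product of reflections carries the negative roots to
    the tournament.

    Call two roots exclusive in D if no inversion set of an element of D contains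
    both. Exclusivity of a and b says - b <= a in phi D, and a nonempty D is a Condorcet
    domain exactly when every root-triple contains an exclusive pair. This
    translates the Condorcet condition on D into the one on phi D
    ([phi_condorcet]), and shows that the symmetric ideals of a Condorcet root
    poset are triple-free, so that they are the inversion sets of the elements of
    psi P. If a <= b fails in P, then some symmetric ideal contains b but not a
    ([symmetric_ideal_separates]); hence phi (psi P) = P.

    Two roots with a strict majority have a common voter, so majority votes on
    psi P give symmetric ideals again, and psi P is closed. Conversely, a closed D
    is stable under majorities of three of its elements, since giving one vote to
    each of the three creates no tie. A family of sets stable under majorities of
    three is determined by its projections to pairs of coordinates
    ([majority3_helly], the argument of Baker and Pixley), and phi D records these
    projections, so psi (phi D) = D. Finally psi (phi D) is the least closed
    domain containing D, because enlarging D weakens phi D. *)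

Set Implicit Arguments.
Unset Strict Implicit.
Unset Printing Implicit Defensive.
Import Order.TTheory GRing.Theory Num.Theory.
Local Open Scope classical_set_scope.
Local Open Scope ring_scope.

(** * Families of sets stable under majorities of three *)

Definition majority3 (T : Type) (A B C : set T) : set T :=
  [set a | (A a /\ B a) \/ (A a /\ C a) \/ (B a /\ C a)].

(** A set of at least three points is covered by three smaller subsets in such a
    way that each point lies in two of them: remove x, y or z. By induction each
    of the three subsets lies in a member of the family, and the majority of
    these members contains the whole set. *)
Lemma majority3_helly (U : Type) (T : choiceType) (D : set U) (F : U -> set T)
    (s : seq T) :
  D !=set0 ->
  (forall u v w, D u -> D v -> D w ->
     exists2 x, D x & majority3 (F u) (F v) (F w) `<=` F x) ->
  (forall a b, a \in s -> b \in s -> exists u, [/\ D u, F u a & F u b]) ->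
  exists2 u, D u & [set` s] `<=` F u.
Proof.
move=> [u0 Du0] maj; have [m] := ubnP (size s); elim: m s => // m IH.
move=> [|x [|y [|z s]]] sm pairs.
- by exists u0.
- have [||u [Du ux _]] := pairs x x; rewrite ?mem_head //; exists u => // a.
  by rewrite /= inE => /eqP ->.
- have [||u [Du ux uy]] := pairs x y; rewrite ?inE ?eqxx ?orbT //.
  by exists u => // a; rewrite /= !inE => /orP[] /eqP ->.
have sub t : (size t < m)%N -> {subset t <= [:: x, y, z & s]} ->
    exists2 u, D u & [set` t] `<=` F u.
  by move=> tm ts; apply: IH => // a b /ts sa /ts sb; exact: pairs.
have [||u Du hu] := sub [:: y, z & s]; first exact: sm.
  by move=> a; rewrite !inE => ->; rewrite orbT.
have [||v Dv hv] := sub [:: x, z & s]; first exact: sm.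
  by move=> a; rewrite !inE => /orP[->|->]; rewrite ?orbT.
have [||w Dw hw] := sub [:: x, y & s]; first exact: sm.
  by move=> a; rewrite !inE => /orP[->|/orP[->|->]]; rewrite ?orbT.
have [t Dt ht] := maj _ _ _ Du Dv Dw; exists t => // a.
rewrite /= inE => /predU1P [->|]; last rewrite inE => /predU1P [->|].
- by apply: ht; right; right; split; [apply: hv|apply: hw]; rewrite /= !inE eqxx.
- by apply: ht; right; left; split; [apply: hu|apply: hw];
    rewrite /= !inE eqxx ?orbT.
rewrite inE => /predU1P [->|sa].
- by apply: ht; left; split; [apply: hu|apply: hv]; rewrite /= !inE eqxx ?orbT.
- by apply: ht; left; split; [apply: hu|apply: hv]; rewrite /= !inE sa ?orbT.
Qed.

(** * The reflection group *)

Section RootSystem.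
Variables (R : realType) (n : nat) (Phi Pos : set 'cV[R]_n).
Hypotheses (hPhi : root_system Phi) (hPos : positive_roots Phi Pos).
Local Notation W := (weyl_group Phi).
Local Notation I_ := (inversion_set Phi Pos).

Lemma dotDr (u v w : 'cV[R]_n) : dot u (v + w) = dot u v + dot u w.
Proof. by rewrite /dot -big_split; apply: eq_bigr => i _; rewrite mxE mulrDr. Qed.

Lemma dotZr c (u v : 'cV[R]_n) : dot u (c *: v) = c * dot u v.
Proof. by rewrite /dot mulr_sumr; apply: eq_bigr => i _; rewrite mxE mulrCA. Qed.

Lemma dotNr (u v : 'cV[R]_n) : dot u (- v) = - dot u v.
Proof. by rewrite -scaleN1r dotZr mulN1r. Qed.

Lemma dot_eq0 (a : 'cV[R]_n) : (dot a a == 0) = (a == 0).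
Proof.
apply/eqP/eqP => [a0|->]; last by rewrite /dot big1 // => i _; rewrite mxE mul0r.
apply/matrixP => i j; rewrite ord1 mxE; apply/eqP.
rewrite -sqrf_eq0 expr2; apply/eqP.
by apply: (psumr_eq0P _ a0) => // k _; rewrite -expr2 sqr_ge0.
Qed.

Lemma root_neq0 a : Phi a -> a != 0.
Proof. by case: hPhi => _ h _ _; exact: h. Qed.

Lemma root_opp a : Phi a -> Phi (- a).
Proof.
move=> pa; case: hPhi => _ _ /(_ _ pa) h _.
by have [] : (Phi `&` [set c *: a | c in [set: R]]) (- a) by rewrite h; right.
Qed.

Lemma root_oppE a : Phi (- a) <-> Phi a.
Proof. by split=> /root_opp; rewrite ?opprK. Qed.

Lemma root_scale a c : Phi a -> Phi (c *: a) -> c *: a = a \/ c *: a = - a.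
Proof.
move=> pa pca; case: hPhi => _ _ /(_ _ pa) h _.
by have : [set a; - a] (c *: a) by rewrite -h; split=> //; exists c.
Qed.

Lemma reflection_root a b : Phi a -> Phi b -> Phi (reflection a *m b).
Proof.
move=> pa pb; case: hPhi => _ _ _ /(_ _ pa) h.
by rewrite -h; exists b.
Qed.

Lemma reflectionK (a : 'cV[R]_n) : a != 0 -> reflection a *m reflection a = 1%:M.
Proof.
move=> a0; have d0 : dot a a != 0 by rewrite dot_eq0.
rewrite {2}/reflection mulmxBr mulmx1 -scalemxAr mulmxA reflectionE.
rewrite mulfK // /reflection.
have -> : a - 2 *: a = - a by rewrite scaler_nat mulr2n opprD addrA subrr add0r.
by rewrite mulNmx scalerN opprK subrK.
Qed.

Lemma invmx_reflection a : Phi a -> invmx (reflection a) = reflection a.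
Proof.
move=> /root_neq0 /reflectionK h.
have [u _] := mulmx1_unit h.
by rewrite -[RHS]mul1mx -(mulVmx u) -mulmxA h mulmx1.
Qed.

Lemma weyl_unit w : W w -> w \in unitmx.
Proof.
elim=> [a /root_neq0/reflectionK h| |u v _ hu _ hv|u _ hu].
- by case: (mulmx1_unit h).
- exact: unitmx1.
- by rewrite unitmx_mul hu.
- by rewrite unitmx_inv.
Qed.

Lemma invmx_mul (u v : 'M[R]_n) : u \in unitmx -> v \in unitmx ->
  invmx (u *m v) = invmx v *m invmx u.
Proof.
move=> uu uv; have uuv : u *m v \in unitmx by rewrite unitmx_mul uu.
apply: (can_inj (mulKmx uuv)); rewrite mulmxV // mulmxA -(mulmxA u).
by rewrite mulmxV // mulmx1 mulmxV.
Qed.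

Lemma weyl_root_stable w : W w ->
  forall a, Phi a -> Phi (w *m a) /\ Phi (invmx w *m a).
Proof.
elim=> [a pa b pb| |u v wu hu wv hv|u wu hu] /=.
- by rewrite invmx_reflection //; split; apply: reflection_root.
- by move=> a pa; rewrite invmx1 mul1mx.
- move=> a pa; split.
    by rewrite -mulmxA; apply (hu _ (hv _ pa).1).
  by rewrite invmx_mul ?weyl_unit // -mulmxA; apply (hv _ (hu _ pa).2).
- by move=> a pa; rewrite invmxK; split; apply hu.
Qed.

(** The rows of w - 1 lie in the span of the roots, so N kills its transpose. *)
Lemma mulmx_weyl_tr (N w : 'M[R]_n) :
  (forall a, Phi a -> N *m a = 0) -> W w -> N *m w^T = N.
Proof.
move=> N0; elim=> [a pa| |u v _ hu _ hv|u wu hu].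
- rewrite /reflection linearB /= linearZ /= trmx_mul trmxK trmx1.
  by rewrite mulmxBr mulmx1 -scalemxAr mulmxA N0 // mul0mx scaler0 subr0.
- by rewrite trmx1 mulmx1.
- by rewrite trmx_mul mulmxA hv hu.
- rewrite -{1}hu -mulmxA -trmx_mul mulVmx ?weyl_unit //.
  by rewrite trmx1 mulmx1.
Qed.

Lemma mulmx_trmx_eq0 (N : 'M[R]_n) : N *m N^T = 0 -> N = 0.
Proof.
move=> N0; apply/matrixP => i j; rewrite mxE; apply/eqP.
rewrite -sqrf_eq0 expr2; apply/eqP.
have /matrixP/(_ i i) := N0; rewrite !mxE => h.
have := @psumr_eq0P _ _ predT _ _ h j isT.
by rewrite mxE; apply => k _; rewrite mxE -expr2 sqr_ge0.
Qed.

(** The difference M of two such elements kills the roots, hence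
    M *m M^T = M *m w^T - M *m v^T = M - M = 0. *)
Lemma weyl_eq_on_roots v w : W v -> W w ->
  (forall a, Phi a -> v *m a = w *m a) -> v = w.
Proof.
move=> Wv Ww vw; apply/eqP; rewrite -subr_eq0; apply/eqP/mulmx_trmx_eq0.
have N0 a : Phi a -> (v - w) *m a = 0 by move=> pa; rewrite mulmxBl vw // subrr.
by rewrite linearB mulmxBr !mulmx_weyl_tr // subrr.
Qed.

Lemma weyl_finite : finite_set W.
Proof.
case: hPhi => /finite_seqP[s sE] _ _ _.
pose k := size s.
pose f (w : 'M[R]_n) :=
  [ffun i : 'I_k => (inord (index (w *m nth 0 s i) s) : 'I_k.+1)].
have sP a : Phi a <-> a \in s by rewrite sE.
have fW : set_inj W f.
  move=> v w /set_mem Wv /set_mem Ww /ffunP fvw.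
  apply: weyl_eq_on_roots => // a pa.
  have /sP va := (weyl_root_stable Wv pa).1.
  have /sP wa := (weyl_root_stable Ww pa).1.
  have ak : (index a s < k)%N by rewrite index_mem; apply/sP.
  have := fvw (Ordinal ak); rewrite !ffunE /= nth_index; last exact/sP.
  move=> /(congr1 val) /=; rewrite !inordK ?ltnS ?index_size //.
  move=> /(congr1 (nth 0 s)); by rewrite !nth_index.
by rewrite -(eq_finite_set (inj_card_eq fW)); exact: finite_finset.
Qed.

(** * Triple-free tournaments are inversion sets *)

Definition tournament (I : set 'cV[R]_n) :=
  I `<=` Phi /\ forall a, Phi a -> I (- a) <-> ~ I a.

Definition triple_free (I : set 'cV[R]_n) :=
  forall a b c, root_triple Phi a b c -> ~ [/\ I a, I b & I c].

Lemma pos_tournament : tournament Pos.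
Proof.
case: hPos => t [t0 ->]; split=> [a []//|a pa].
rewrite /= root_oppE dotNr oppr_gt0.
have := t0 _ pa; case: ltgtP => // _ _; intuition.
Qed.

Lemma inversion_setP t w a : W w -> Pos = [set a | Phi a /\ 0 < dot t a] ->
  I_ w a <-> Phi a /\ dot t (invmx w *m a) <= 0.
Proof.
move=> Ww PosE; rewrite /inversion_set PosE /=.
split=> -[pa h]; have pw := (weyl_root_stable Ww pa).2; split=> //.
  by rewrite leNgt; apply/negP => h'; case: h => _; apply.
by split=> // -[_]; rewrite ltNge h.
Qed.

Lemma inversion_tournament w : W w -> tournament (I_ w).
Proof.
move=> Ww; split=> [a []//|a pa]; have pw := (weyl_root_stable Ww pa).2.
have [_ hN] := pos_tournament; have := hN _ pw.
rewrite /inversion_set /= mulmxN !root_oppE; tauto.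
Qed.

(** A combination with positive coefficients of roots on one side of a hyperplane
    is not 0. *)
Lemma inversion_triple_free w : W w -> triple_free (I_ w).
Proof.
move=> Ww a b c [pa pb pc _ [x [y [z [x0 y0 z0 e]]]]].
case: hPos => t [t0 PosE].
have side d : I_ w d -> dot t (invmx w *m d) < 0.
  move=> /(inversion_setP _ Ww PosE) [pd h]; rewrite lt_neqAle h andbT.
  exact: t0 (weyl_root_stable Ww pd).2.
case=> /side ha /side hb /side hc.
have := congr1 (fun v => dot t (invmx w *m v)) e.
rewrite /= !mulmxDr -!scalemxAr !dotDr !dotZr mulmx0.
have -> : dot t (0 : 'cV_n) = 0 by rewrite -(scale0r 0) dotZr mul0r.
have := mulr_gt0 x0 (y := - dot t (invmx w *m a)); rewrite oppr_gt0 => /(_ ha).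
have := mulr_gt0 y0 (y := - dot t (invmx w *m b)); rewrite oppr_gt0 => /(_ hb).
have := mulr_gt0 z0 (y := - dot t (invmx w *m c)); rewrite oppr_gt0 => /(_ hc).
by rewrite !mulrN; lra.
Qed.

Lemma root_tripleN a b c :
  root_triple Phi a b c -> root_triple Phi (- a) (- b) (- c).
Proof.
move=> [pa pb pc [ab ac bc] [x [y [z [x0 y0 z0 e]]]]].
split; rewrite ?root_oppE // ?(inj_eq oppr_inj) //.
exists x, y, z; split=> //.
by rewrite !scalerN -!opprD e oppr0.
Qed.

Lemma root_triple_weyl w a b c : W w ->
  root_triple Phi a b c -> root_triple Phi (w *m a) (w *m b) (w *m c).
Proof.
move=> Ww [pa pb pc [ab ac bc] [x [y [z [x0 y0 z0 e]]]]].
have wI := can_inj (mulKmx (weyl_unit Ww)).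
split; rewrite ?(inj_eq (wI _)) //; try exact: (weyl_root_stable Ww _).1.
by exists x, y, z; rewrite !scalemxAr -!mulmxDr e mulmx0.
Qed.

Lemma reflection_self a : Phi a -> reflection a *m a = - a.
Proof.
move=> /root_neq0 a0; rewrite reflectionE mulfK ?dot_eq0 //.
by rewrite scaler_nat mulr2n opprD addrA subrr add0r.
Qed.

Section ReflectTournament.
Variables (I : set 'cV[R]_n) (a : 'cV[R]_n).
Hypotheses (tI : tournament I) (fI : triple_free I) (Ia : I a) (Pa : Pos a).

Definition reflected : set 'cV[R]_n := [set b | Phi b /\ I (reflection a *m b)].

Let pa : Phi a. Proof. exact: tI.1. Qed.
Let Wr : W (reflection a). Proof. exact: weyl_reflection. Qed.
Let rK (b : 'cV[R]_n) : reflection a *m (reflection a *m b) = b.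
Proof. by rewrite mulmxA reflectionK ?mul1mx ?root_neq0. Qed.

Lemma reflected_tournament : tournament reflected.
Proof.
split=> [b []//|b pb]; rewrite /reflected /= root_oppE mulmxN.
have := tI.2 _ (weyl_root_stable Wr pb).1; tauto.
Qed.

Lemma reflected_triple_free : triple_free reflected.
Proof.
move=> b c d tr [[_ hb] [_ hc] [_ hd]].
exact: (fI (root_triple_weyl Wr tr)).
Qed.

Lemma reflected_inversion w : W w -> I_ w = reflected ->
  I_ (reflection a *m w) = I.
Proof.
move=> Ww wE; apply/seteqP; split=> b.
  case=> pb; rewrite invmx_mul ?weyl_unit // invmx_reflection // -mulmxA => h.
  have : I_ w (reflection a *m b) by split=> //; exact: reflection_root.
  by rewrite wE => -[_]; rewrite rK.
move=> Ib; have pb := tI.1 _ Ib; split=> //.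
rewrite invmx_mul ?weyl_unit // invmx_reflection // -mulmxA.
have : reflected (reflection a *m b) by split; [exact: reflection_root|rewrite rK].
by rewrite -wE => -[].
Qed.

(** Let b' be the image of b. Both b and - b' are positive and their sum is a
    multiple of a, which is then a positive multiple; so a, - b, b' is a
    root-triple. As I contains a and b', it does not contain - b. *)
Lemma reflected_neg b : reflected b -> Pos b -> ~ Pos (reflection a *m b) -> I b.
Proof.
move=> [pb Irb] Pb nPrb; apply: contrapT => /(tI.2 _ pb) Inb.
have prb : Phi (reflection a *m b) by exact: reflection_root.
case: hPos => t [t0 PosE].
have ta : 0 < dot t a by move: Pa; rewrite PosE => -[].
have tb : 0 < dot t b by move: Pb; rewrite PosE => -[].
have trb : dot t (reflection a *m b) < 0.
  rewrite ltNge; apply/negP => h; apply: nPrb; rewrite PosE; split=> //.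
  by rewrite lt_neqAle eq_sym h t0.
pose c := 2 * dot a b / dot a a.
have rE : reflection a *m b = b - c *: a by rewrite reflectionE.
have c0 : 0 < c.
  by move: trb; rewrite rE dotDr dotNr dotZr => h; rewrite -(pmulr_lgt0 _ ta); lra.
apply: (fI (a := a) (b := - b) (c := reflection a *m b)) => //.
split=> //; first exact: root_opp.
- split.
  + by apply/eqP => h; move: tb; rewrite -[b]opprK -h dotNr; lra.
  + by apply/eqP => h; move: trb; rewrite -h; lra.
  (* If - b = b', then b is a multiple of a, so b = a and b' = - a, which is
     not in I. *)
  + apply/eqP => h; have bE : b = (c / 2) *: a.
      have e : 2 *: b = c *: a.
        apply/eqP; rewrite -subr_eq0 scaler_nat mulr2n -addrA -rE -h.
        by rewrite subrr.
      by rewrite mulrC -scalerA -e scalerA mulVf ?pnatr_eq0 // scale1r.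
    have := @root_scale _ (c / 2) pa; rewrite -bE => /(_ pb) [ba|ba].
      by move: Inb; rewrite ba => /(tI.2 _ pa).
    by move: tb; rewrite ba dotNr; lra.
- exists c, 1, 1; split=> //; rewrite rE !scale1r.
  by rewrite addrA subrK subrr.
Qed.

(** Send b to its image under the reflection if this is positive, and to b
    otherwise. By [reflected_neg] this maps positive members of the reflected
    tournament to positive members of I; it is injective and misses a. *)
Lemma reflected_count (s : seq 'cV[R]_n) : uniq s -> Phi = [set` s] ->
  (size [seq b <- s | `[< reflected b /\ Pos b >]] <
   size [seq b <- s | `[< I b /\ Pos b >]])%N.
Proof.
move=> us sE; have sP b : Phi b -> b \in s by rewrite sE.
pose m b := if `[< Pos (reflection a *m b) >] then reflection a *m b else b.
set F' := [seq b <- s | `[< reflected b /\ Pos b >]].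
have F'P b : b \in F' -> reflected b /\ Pos b.
  by rewrite mem_filter => /andP[/asboolP].
have [_ tP] := pos_tournament.
have mP b : b \in F' -> I (m b) /\ Pos (m b).
  move=> /F'P [rb Pb]; rewrite /m; case: asboolP => h; first by case: rb.
  by split=> //; exact: reflected_neg.
rewrite -(size_map m) -[(size _).+1]/(size (a :: map m F')).
apply: uniq_leq_size.
  rewrite /= map_inj_in_uniq ?filter_uniq // ?andbT.
    apply/mapP => -[b /F'P [[pb Irb] Pb]]; rewrite /m; case: asboolP => h e.
      move: Pb; rewrite -[b]rK -e reflection_self // => /(tP _ pa); exact.
    by move: Irb; rewrite -e reflection_self // => /(tI.2 _ pa).
  move=> b1 b2 /F'P [_ P1] /F'P [_ P2]; rewrite /m.
  case: asboolP => h1; case: asboolP => h2 e //.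
  - by rewrite -[b1]rK e rK.
  - by case: h2; rewrite -e rK.
  - by case: h1; rewrite e rK.
move=> b; rewrite inE => /predU1P [->|/mapP[d /mP [h1 h2] ->]].
  by rewrite mem_filter sP // andbT; apply/asboolP.
by rewrite mem_filter sP ?andbT //; [exact/asboolP|exact: tI.1].
Qed.

End ReflectTournament.

(** Reflecting in a positive member lowers the number of positive members;
    the only tournament without positive members is the set of negative roots,
    the inversion set of 1. *)
Theorem tournament_inversion I : tournament I -> triple_free I ->
  exists2 w, W w & I_ w = I.
Proof.
case: hPhi => /finite_seqP[s0 s0E] _ _ _.
pose s := undup s0; have us : uniq s by exact: undup_uniq.
have sE : Phi = [set` s].
  by rewrite s0E; apply/seteqP; split=> x /=; rewrite mem_undup.
move: {2}(size _).+1 (ltnSn (size [seq b <- s | `[< I b /\ Pos b >]])) => m.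
elim: m I => // m IH I; rewrite ltnS => Im tI fI.
have [[a [Ia Pa]]|noP] := pselect (exists a, I a /\ Pos a).
  have [||| w Ww wE] := IH (reflected I a).
  - exact: leq_trans (reflected_count tI fI Ia Pa us sE) Im.
  - exact: reflected_tournament.
  - exact: reflected_triple_free.
  exists (reflection a *m w); last exact: reflected_inversion.
  by apply: weyl_mul => //; apply/weyl_reflection/tI.1.
exists 1%:M; first exact: weyl_one.
have [_ tP] := pos_tournament.
apply/seteqP; split=> a.
  case=> pa; rewrite invmx1 mul1mx => -[_ nP].
  apply: contrapT => /(tI.2 _ pa) h; apply: noP; exists (- a); split=> //.
  exact/tP.
move=> Ia; have pa := tI.1 _ Ia; split=> //; rewrite invmx1 mul1mx; split=> // Pa.
by apply: noP; exists a.
Qed.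

(** * Condorcet domains and exclusive pairs *)

Local Notation condorcet := (condorcet_domain Phi Pos).
Local Notation closed_condorcet := (closed_condorcet_domain Phi Pos).
Local Notation phi_ := (phi Phi Pos).
Local Notation psi_ := (psi Phi Pos).

Definition exclusive (D : set 'M[R]_n) (a b : 'cV[R]_n) :=
  forall u, D u -> ~ (I_ u a /\ I_ u b).

Lemma exclusiveC D a b : exclusive D a b -> exclusive D b a.
Proof. by move=> h u Du []; move: (h _ Du); tauto. Qed.

Lemma exclusivePn D a b :
  ~ exclusive D a b -> exists u, [/\ D u, I_ u a & I_ u b].
Proof.
move=> h; apply: contrapT => hN; apply: h => u Du [ua ub].
by apply: hN; exists u.
Qed.

Lemma phi_exclusive D a b : D `<=` W -> Phi a -> Phi b ->
  phi_ D (- b) a <-> exclusive D a b.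
Proof.
move=> DW pa pb; split=> [[_ _ h] u Du [ua ub]|h].
  have [_] : [set v | D v /\ I_ v (- b)] u by apply: h.
  by move=> /((inversion_tournament (DW _ Du)).2 _ pb).
split; rewrite ?root_oppE // => u [Du ua]; split=> //.
by apply/((inversion_tournament (DW _ Du)).2 _ pb) => ub; apply: (h u).
Qed.

Lemma exclusive_pair_condorcet D : D `<=` W -> D !=set0 ->
  (forall a b c, root_triple Phi a b c ->
     [\/ exclusive D a b, exclusive D a c | exclusive D b c]) ->
  condorcet D.
Proof.
move=> DW D0 h; split=> // -[u [v [w [a [b [c]]]]]].
move=> [[Du Dv Dw] _ tr [uab vac wbc]].
by case: (h _ _ _ tr) => [/(_ u Du)|/(_ v Dv)|/(_ w Dw)].
Qed.

(** Three witnesses against exclusivity of the pairs of a root-triple are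
    distinct, because none of them contains the whole triple. *)
Lemma condorcet_exclusive_pair D a b c : condorcet D -> root_triple Phi a b c ->
  [\/ exclusive D a b, exclusive D a c | exclusive D b c].
Proof.
move=> [DW _ cD] tr; apply: contrapT => hN; apply: cD.
have [u [Du ua ub]] : exists u, [/\ D u, I_ u a & I_ u b].
  by apply: exclusivePn => h; apply: hN; apply: Or31.
have [v [Dv va vc]] : exists u, [/\ D u, I_ u a & I_ u c].
  by apply: exclusivePn => h; apply: hN; apply: Or32.
have [w [Dw wb wc]] : exists u, [/\ D u, I_ u b & I_ u c].
  by apply: exclusivePn => h; apply: hN; apply: Or33.
have tf x : D x -> ~ [/\ I_ x a, I_ x b & I_ x c].
  by move=> /DW Wx; exact: (inversion_triple_free Wx).
exists u, v, w, a, b, c; split=> //.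
by split; apply/eqP => e; [apply: (tf u)|apply: (tf u)|apply: (tf v)] => //;
  split=> //; rewrite e.
Qed.

Lemma phi_antipodal D : condorcet D -> antipodal_root_poset Phi (phi_ D).
Proof.
move=> [DW [u Du] _]; have tD v (Dv : D v) := (inversion_tournament (DW _ Dv)).2.
split.
- split=> [a b []//|a pa|a b c [pa pb ba] [_ pc cb]]; first by split.
  by split=> // v /cb /ba.
- move=> a b pa pb [_ _ ba]; split; rewrite ?root_oppE // => v [Dv va].
  split=> //; apply/(tD _ Dv) => // vb.
  have [_ va'] : [set v | D v /\ I_ v a] v by apply: ba.
  by move: va => /(tD _ Dv _ pa).
- move=> c pc; have pNc : Phi (- c) by rewrite root_oppE.
  split=> [[[_ _ h1] [_ _ h2]]|[[_ _ h1] h2] d pd].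
    have := tD _ Du c pc; have := h1 u; have := h2 u; rewrite /=; tauto.
  split=> // v [Dv vd]; split=> //; apply: contrapT => vc.
  have vNc : I_ v (- c) by exact/(tD _ Dv).
  by have [] : [set v | D v /\ I_ v c] v by apply: h1.
Qed.

(** A root-triple contains a D-exclusive pair, and so does its opposite. If the
    two pairs agree up to sign, the two roots of the pair are opposite in the
    poset. Otherwise the pairs share, up to sign, one root c, and - c lies between
    the other two. *)
Lemma phi_condorcet D : condorcet D -> condorcet_root_poset Phi (phi_ D).
Proof.
move=> cD; split; first exact: phi_antipodal.
move=> a b c tr; have [pa pb pc _ _] := tr; have [DW _ _] := cD.
have le1 x y : Phi x -> Phi y -> exclusive D x y -> phi_ D (- y) x.
  by move=> px py h; apply/phi_exclusive.
have le2 x y : Phi x -> Phi y -> exclusive D (- x) (- y) -> phi_ D y (- x).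
  by move=> px py h; rewrite -[y]opprK; apply/phi_exclusive; rewrite ?root_oppE.
(* z is the root shared by the exclusive pair x, z of the triple and by the
   exclusive pair of its opposite. *)
have pE x y z : perm_eq [:: x; y; z] [:: a; b; c] ->
   [/\ Phi x, Phi y & Phi z] ->
   exclusive D x z -> exclusive D (- x) (- z) \/ exclusive D (- z) (- y) ->
   exists a' b' c', perm_eq [:: a'; b'; c'] [:: a; b; c] /\
     ((phi_ D (- c') a' /\ phi_ D b' (- c')) \/
      (phi_ D a' (- c') /\ phi_ D (- c') a')).
  move=> pm [px py pz] h1 h2; exists x, y, z; split=> //.
  case: h2 => h2; [right|left]; split; try exact: le1; last exact: le2.
  by apply: le2 => //; exact: exclusiveC.
have h2 := condorcet_exclusive_pair cD (root_tripleN tr).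
have pm x y z :
    (forall p : pred 'cV[R]_n,
       p x + (p y + (p z + 0)) = p a + (p b + (p c + 0)))%N ->
  perm_eq [:: x; y; z] [:: a; b; c] by move=> h; apply/permP.
case: (condorcet_exclusive_pair cD tr) => h1; case: h2 => h2.
- apply: (pE a c b); [by apply: pm => p; lia|by []|by []|by left].
- apply: (pE b c a); [by apply: pm => p; lia|by []|exact: exclusiveC|by right].
- apply: (pE a c b); [by apply: pm => p; lia|by []|by []|by right].
- apply: (pE c b a); [by apply: pm => p; lia|by []|exact: exclusiveC|by right].
- apply: (pE a b c); [by apply: pm => p; lia|by []|by []|by left].
- apply: (pE a b c); [by apply: pm => p; lia|by []|by []|].
  by right; exact: exclusiveC.
- apply: (pE c a b); [by apply: pm => p; lia|by []|exact: exclusiveC|].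
  by right; exact: exclusiveC.
- apply: (pE b a c); [by apply: pm => p; lia|by []|by []|].
  by right; exact: exclusiveC.
- apply: (pE b a c); [by apply: pm => p; lia|by []|by []|by left].
Qed.

Lemma symmetric_idealsP le I : symmetric_ideals Phi le I <->
  tournament I /\ (forall a b, I b -> le a b -> I a).
Proof.
split=> [[[IPhi hI] hU h0]|[[IPhi hT] hI]].
  split=> //; split=> // a pa; split=> [INa Ia|nIa].
    suff : (I `&` [set - a | a in I]) a by rewrite h0.
    by split=> //; exists (- a); rewrite ?opprK.
  have : (I `|` [set - a | a in I]) a by rewrite hU.
  by case=> // -[b Ib <-]; rewrite opprK.
split=> //; apply/seteqP; split=> a //.
- by case=> [/IPhi|[b /IPhi pb <-]] //; rewrite root_oppE.
- move=> pa; have [Ia|/(hT _ pa) INa] := pselect (I a); first by left.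
  by right; exists (- a); rewrite ?opprK.
- by case=> Ia [b Ib ba]; have := hT _ (IPhi _ Ib); rewrite ba => -[/(_ Ia)].
Qed.

(** * Symmetric ideals of a Condorcet root poset *)

Section PosetOrderIdeals.
Variable le : 'cV[R]_n -> 'cV[R]_n -> Prop.
Hypothesis leP : condorcet_root_poset Phi le.

Let leanti : antipodal_root_poset Phi le. Proof. exact: leP.1. Qed.
Let le_root a b : le a b -> Phi a /\ Phi b.
Proof. by case: leanti => -[h _ _] _ _; exact: h. Qed.
Let le_refl a : Phi a -> le a a.
Proof. by case: leanti => -[_ h _] _ _; exact: h. Qed.
Let le_trans a b c : le a b -> le b c -> le a c.
Proof. by case: leanti => -[_ _ h] _ _; exact: h. Qed.
Let le_opp a b : le a b -> le (- b) (- a).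
Proof. by move=> h; have [pa pb] := le_root h; case: leanti => _ H _; exact: H. Qed.
Let le_min c d : le c (- c) -> Phi d -> le c d.
Proof.
move=> h pd; have [pc _] := le_root h; case: leanti => _ _ /(_ _ pc) [nn mn].
by apply: mn => //; split=> // h'; apply: nn.
Qed.

(** Both alternatives in the axiom on root-triples imply - z <= x for two roots
    x, z of the triple, and this relation is symmetric in x and z. *)
Lemma poset_triple_pair a b c : root_triple Phi a b c ->
  [\/ le (- b) a, le (- c) a | le (- c) b].
Proof.
move=> tr; have [_ _ _ [/eqP ab /eqP ac /eqP bc] _] := tr.
have [x [y [z [pm h]]]] := leP.2 _ _ _ tr.
have lexz : le (- z) x by case: h => -[].
have lezx : le (- x) z by rewrite -[z]opprK; exact: le_opp.
have : uniq [:: x; y; z].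
  rewrite (perm_uniq pm) /= !inE !andbT negb_or.
  by apply/andP; split; [apply/andP; split|]; apply/eqP.
rewrite /= !inE negb_or !andbT => /andP[/andP[_ /eqP xz] _].
have := perm_mem pm x; have := perm_mem pm z; rewrite !inE !eqxx !orbT /=.
move=> /esym /or3P hz /esym /or3P hx.
case: hz => /eqP ez; case: hx => /eqP ex; subst x z => //;
  by [apply: Or31|apply: Or32|apply: Or33].
Qed.

(** If - b <= a, an ideal that contains a contains - b, hence not b. *)
Lemma symmetric_ideal_triple_free I : symmetric_ideals Phi le I -> triple_free I.
Proof.
move=> /symmetric_idealsP [[IP tI] hI] a b c tr [Ia Ib Ic].
by case: (poset_triple_pair tr) => h; have := hI _ _ _ h;
  [move=> /(_ Ia) /tI|move=> /(_ Ia) /tI|move=> /(_ Ib) /tI]; apply=> //; apply: IP.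
Qed.

Lemma symmetric_ideal_inversion I : symmetric_ideals Phi le I ->
  exists2 w, psi_ le w & I_ w = I.
Proof.
move=> sI; have /symmetric_idealsP [tI _] := sI.
have [w Ww wE] := tournament_inversion tI (symmetric_ideal_triple_free sI).
by exists w => //; split=> //; rewrite wE.
Qed.

(** A partial version of a symmetric ideal: a pair of opposite roots may be left
    undecided. *)
Definition consistent_ideal (J : set 'cV[R]_n) :=
  [/\ J `<=` Phi, forall a b, J b -> le a b -> J a & forall a, J a -> ~ J (- a)].

(** If neither y nor - y lies in J, the down-set of y can be added: a conflict
    z <= y with - z in J puts - y in J, and a conflict z, - z <= y makes - y a
    minimum, which lies in every nonempty ideal. *)
Lemma consistent_ideal_decide J y : consistent_ideal J -> J !=set0 -> Phi y ->
  exists J', [/\ consistent_ideal J', J `<=` J' & J' y \/ J' (- y)].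
Proof.
move=> cJ [x0 Jx0] py; have [JP Jd Jc] := cJ.
have [h|h] := pselect (J y \/ J (- y)).
  by exists J; split=> // z.
have nle z : le z y -> ~ J (- z).
  by move=> zy Jz; apply: h; right; apply: Jd Jz _; exact: le_opp.
exists (J `|` [set z | le z y]); split; last by left; right; exact: le_refl.
  split=> [z [/JP //|/le_root []//]|a b [Jb|/= zb] ab|a [Ja|/= ya] [Ja'|/= ya']].
  - by left; exact: Jd ab.
  - by right; exact: le_trans zb.
  - exact: Jc Ja'.
  - by have := nle _ ya'; rewrite opprK.
  - exact: nle ya _.
  - apply: h; right; apply: Jd (Jx0) _; apply: le_min (JP _ Jx0).
    by rewrite opprK; apply: le_trans (ya); rewrite -[a]opprK; exact: le_opp.
by move=> z Jz; left.
Qed.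

Lemma consistent_ideal_extend J : consistent_ideal J -> J !=set0 ->
  exists2 I, symmetric_ideals Phi le I & J `<=` I.
Proof.
move=> cJ [x0 Jx0]; have [/finite_seqP[s sE] _ _ _] := hPhi.
suff [I [[IP Id Ic] JI Is]] : exists I, [/\ consistent_ideal I, J `<=` I &
    forall y, y \in s -> I y \/ I (- y)].
  exists I => //; apply/symmetric_idealsP; split=> //; split=> // a pa.
  split; first by move=> h /Ic.
  by move=> nI; have : a \in s by [move: pa; rewrite sE]; case/Is.
have {sE} : {subset s <= [pred x | `[< Phi x >]]}.
  by move=> x xs; apply/asboolP; rewrite sE.
elim: s => [_|y s IH sP]; first by exists J; split=> // z; rewrite ?in_nil.
have [|I [cI JI Is]] := IH; first by move=> x xs; apply: sP; rewrite inE xs orbT.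
have [||I' [cI' II' hy]] := @consistent_ideal_decide I y cI.
- by exists x0; exact: JI.
- by apply/asboolP; apply: (sP y); rewrite inE eqxx.
exists I'; split=> //; first by move=> z /JI /II'.
move=> z; rewrite inE => /predU1P [-> //|/Is [/II' h|/II' h]]; by [left|right].
Qed.

(** The ideal generated by b and - a is consistent: two opposite roots in it
    would give a <= b, either directly or because - b or a would be a minimum. *)
Lemma symmetric_ideal_separates a b : Phi a -> Phi b -> ~ le a b ->
  exists I, [/\ symmetric_ideals Phi le I, I b & ~ I a].
Proof.
move=> pa pb nab; have pNa : Phi (- a) by rewrite root_oppE.
pose J := [set z | le z b \/ le z (- a)].
have [||I sI JI] := @consistent_ideal_extend J.
- split=> [z [/le_root[]//|/le_root[]//]|x y [yb|ya] xy|z].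
  + by left; exact: le_trans yb.
  + by right; exact: le_trans ya.
  + move=> [zb|za] [zb'|za']; apply: nab.
    * have Nbz : le (- b) z by rewrite -[z]opprK; exact: le_opp.
      have := le_min (c := - b); rewrite opprK => /(_ (- a) (le_trans Nbz zb)).
      by move=> /(_ pNa) /le_opp; rewrite !opprK.
    * by apply: le_trans zb; rewrite -[a]opprK -[z]opprK; exact: le_opp.
    * by apply: le_trans zb'; rewrite -[a]opprK; exact: le_opp.
    * apply: le_min pb; apply: le_trans za; rewrite -[a]opprK -[z]opprK.
      exact: le_opp.
- by exists b; left; exact: le_refl.
exists I; split=> //; first by apply: JI; left; exact: le_refl.
have [[_ tI] _] := (symmetric_idealsP le I).1 sI.
by apply/(tI _ pa)/JI; right; exact: le_refl.
Qed.

Lemma phi_psi : phi_ (psi_ le) = le.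
Proof.
apply/funext => a; apply/funext => b; apply/propext; split=> [[pa pb h]|ab].
  apply: contrapT => nab.
  have [I [sI Ib nIa]] := symmetric_ideal_separates pa pb nab.
  have [w ww wE] := symmetric_ideal_inversion sI.
  apply: nIa; rewrite -wE.
  by have [] : [set v | psi_ le v /\ I_ v a] w by apply: h; split=> //; rewrite wE.
have [pa pb] := le_root ab; split=> // w [ww wb]; split=> //.
by have [_ /symmetric_idealsP [_ h]] := ww; exact: h ab.
Qed.

(** A root and its opposite are not equal in the poset, so that some symmetric
    ideal separates them. *)
Lemma symmetric_ideal_exists : symmetric_ideals Phi le !=set0.
Proof.
have [[c pc]|no] := pselect (Phi !=set0).
  have pNc : Phi (- c) by rewrite root_oppE.
  have : ~ le c (- c) \/ ~ le (- c) c.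
    by case: leanti => _ _ /(_ _ pc) [h _]; apply: contrapT => h'; tauto.
  by case=> /symmetric_ideal_separates [] // I [sI _ _]; exists I.
exists set0; apply/symmetric_idealsP; split=> //; split=> // a pa.
by case: no; exists a.
Qed.

Lemma psi_condorcet : condorcet (psi_ le).
Proof.
apply: exclusive_pair_condorcet.
- by move=> w [].
- have [I /symmetric_ideal_inversion [w ww _]] := symmetric_ideal_exists.
  by exists w.
- have ex a b : Phi b -> le (- b) a -> exclusive (psi_ le) a b.
    move=> pb ba w [Ww /symmetric_idealsP [tI h]] [wa wb].
    by have /(tI.2 _ pb) := h _ _ wa ba.
  move=> a b c tr; have [pa pb pc _ _] := tr.
  case: (poset_triple_pair tr) => h;
    by [apply: Or31; exact: ex|apply: Or32; exact: ex|apply: Or33; exact: ex].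
Qed.

End PosetOrderIdeals.

(** * Majority votes *)

Lemma votes_forE D f a : votes_for Phi Pos D f a =
  \sum_(w \in D) (if w \in [set w | I_ w a] then (f w)%:R else 0 : R).
Proof. exact: fsbig_mkcondr. Qed.

Lemma ler_fsum (D : set 'M[R]_n) (f g : 'M[R]_n -> R) : finite_set D ->
  (forall w, D w -> f w <= g w) -> \sum_(w \in D) f w <= \sum_(w \in D) g w.
Proof.
move=> fD fg; rewrite !fsbig_finite // !big_seq; apply: ler_sum => w.
by rewrite in_fset_set // => /set_mem; exact: fg.
Qed.

(** Otherwise the voters for a and those for b would be disjoint, and together
    more than all. *)
Lemma strict_majorities_meet D f a b : D `<=` W ->
  total_votes D f / 2 < votes_for Phi Pos D f a ->
  total_votes D f / 2 < votes_for Phi Pos D f b ->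
  exists u, [/\ D u, I_ u a & I_ u b].
Proof.
move=> DW ha hb; apply: contrapT => no.
have fD : finite_set D by apply: sub_finite_set DW weyl_finite.
suff : votes_for Phi Pos D f a + votes_for Phi Pos D f b <= total_votes D f by lra.
rewrite !votes_forE -fsbig_split //; apply: ler_fsum => // w Dw.
have f0 : 0 <= (f w)%:R :> R by exact: ler0n.
case: ifPn => [/set_mem /= wa|_]; case: ifPn => [/set_mem /= wb|_] /=; try lra.
by case: no; exists w.
Qed.

(** As there is no tie, all roots of I(w) have a strict majority for a majority
    result w. If a <= b with b but not a in I(w), then b and - a have a common
    voter in psi P, whose inversion set is not an ideal. *)
Lemma nu_psi le : preposet Phi le -> nu Phi Pos (psi_ le) `<=` psi_ le.
Proof.
move=> [leR _ _] w [f [_ nt] [Ww wf]]; split=> //.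
have tw := inversion_tournament Ww.
have sm c : I_ w c ->
    total_votes (psi_ le) f / 2 < votes_for Phi Pos (psi_ le) f c.
  by move=> /wf [pc h]; rewrite lt_neqAle h andbT eq_sym nt.
apply/symmetric_idealsP; split=> // a b wb ab; have [pa pb] := leR _ _ ab.
apply: contrapT => /(tw.2 _ pa) wa.
have psiW : psi_ le `<=` W by move=> v [].
have [u [[Wu]]] := strict_majorities_meet psiW (sm _ wa) (sm _ wb).
move=> /symmetric_idealsP [tu hu] ua ub.
by move: ua => /(tu.2 _ pa); apply; exact: hu ab.
Qed.

Lemma sum_indicator (D : set 'M[R]_n) u (P : set 'M[R]_n) : finite_set D -> D u ->
  \sum_(w \in D) (if w \in P then (w == u)%:R else 0 : R) = (u \in P)%:R.
Proof.
move=> fD Du; rewrite (fsbigD1 u) //= eqxx fsbig1 ?addr0.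
  by case: ifP.
by move=> w [_ /eqP/negPf ->]; rewrite if_same.
Qed.

(** The profile giving one vote to each of u, v, w (counted with repetition)
    has three votes in total, hence no tie. *)
Lemma nu_majority3 D u v w x : D `<=` W -> D u -> D v -> D w -> W x ->
  I_ x `<=` majority3 (I_ u) (I_ v) (I_ w) -> nu Phi Pos D x.
Proof.
move=> DW Du Dv Dw Wx hx.
have fD : finite_set D by apply: sub_finite_set DW weyl_finite.
pose f z : nat := ((z == u) + (z == v) + (z == w))%N.
have sumE (P : set 'M[R]_n) :
    \sum_(z \in D) (if z \in P then (f z)%:R else 0 : R) =
    (u \in P)%:R + (v \in P)%:R + (w \in P)%:R.
  rewrite -!(sum_indicator _ fD) // -!fsbig_split //; apply: eq_fsbigr => z _.
  by case: ifP => _ /=; rewrite ?addr0 // /f !natrD.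
have totE : total_votes D f = 3.
  rewrite /total_votes; have := sumE setT; rewrite !in_setT => h.
  transitivity (1 + 1 + 1 : R); last by lra.
  by rewrite -h; apply: eq_fsbigr => z _; rewrite in_setT.
exists f.
  split; first by exists u; rewrite ?/f ?eqxx.
  move=> a pa; rewrite votes_forE sumE totE; apply/eqP.
  by do 3 case: (_ \in _) => /=; lra.
split=> // a xa; have pa : Phi a by case: xa.
split=> //; rewrite votes_forE sumE totE.
have [[h1 h2]|[[h1 h2]|[h1 h2]]] := hx _ xa;
  rewrite (mem_set (h1 : [set z | I_ z a] _)) (mem_set (h2 : [set z | I_ z a] _));
  by case: (_ \in _) => /=; lra.
Qed.

Lemma sub_nu D : D `<=` W -> D `<=` nu Phi Pos D.
Proof.
move=> DW u Du; apply: (nu_majority3 (u := u) (v := u) (w := u)) => //.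
  exact: DW.
by move=> a ua; left.
Qed.

Lemma psi_closed le : condorcet_root_poset Phi le -> closed_condorcet (psi_ le).
Proof.
move=> leP; split; first exact: psi_condorcet.
apply/seteqP; split; last by apply: sub_nu => w [].
by apply: nu_psi; case: leP => -[].
Qed.

(** Two members of a majority of three sets lie together in one of the sets, so
    a root-triple in the majority would have no exclusive pair. *)
Lemma majority3_inversion D u v w : condorcet D -> D u -> D v -> D w ->
  exists2 x, W x & I_ x = majority3 (I_ u) (I_ v) (I_ w).
Proof.
move=> cD Du Dv Dw; have [DW _ _] := cD.
apply: tournament_inversion.
  split=> [a [|[|]] [[]]//|a pa]; rewrite /majority3 /=.
  have := (inversion_tournament (DW _ Du)).2 _ pa.
  have := (inversion_tournament (DW _ Dv)).2 _ pa.
  have := (inversion_tournament (DW _ Dw)).2 _ pa.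
  move=> /propext -> /propext -> /propext ->.
  case: (pselect (I_ u a)) => ua; case: (pselect (I_ v a)) => va;
    by case: (pselect (I_ w a)) => wa; tauto.
move=> a b c tr [ha hb hc].
by case: (condorcet_exclusive_pair cD tr) => h;
  have := h _ Du; have := h _ Dv; have := h _ Dw;
  rewrite /majority3 /= in ha hb hc; tauto.
Qed.

(** * Closed domains *)

Lemma sub_psi_phi D : D `<=` W -> D `<=` psi_ (phi_ D).
Proof.
move=> DW w Dw; split; first exact: DW.
apply/symmetric_idealsP; split; first exact/inversion_tournament/DW.
by move=> a b wb [_ _ h]; have [] : [set v | D v /\ I_ v a] w by apply: h.
Qed.

(** A closed Condorcet domain is closed under majorities of three. A member w of
    psi (phi D) agrees with some element of D on any two roots of its inversion
    set, for otherwise this set would not be an ideal of phi D; hence it agrees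
    with one element of D on all of them. *)
Lemma psi_phi D : closed_condorcet D -> psi_ (phi_ D) = D.
Proof.
move=> [cD nuD]; have [DW D0 _] := cD; apply/seteqP; split; last exact: sub_psi_phi.
move=> w [Ww /symmetric_idealsP [tw hw]].
have [/finite_seqP[s sE] _ _ _] := hPhi.
pose t := [seq a <- s | `[< I_ w a >]].
have tP a : a \in t <-> I_ w a.
  rewrite mem_filter; split=> [/andP[/asboolP]//|wa].
  by rewrite asboolT //=; have := tw.1 _ wa; rewrite sE.
have [|a b /tP wa /tP wb|u Du hu] := @majority3_helly _ _ D I_ t D0.
- move=> x y z Dx Dy Dz; have [v Wv vE] := majority3_inversion cD Dx Dy Dz.
  exists v; last by rewrite vE.
  by rewrite -nuD; apply: (nu_majority3 DW Dx Dy Dz) => //; rewrite vE.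
- apply: exclusivePn => /(phi_exclusive DW (tw.1 _ wa) (tw.1 _ wb)) h.
  by have /(tw.2 _ (tw.1 _ wb)) := hw _ _ wa h.
rewrite -nuD; apply: (nu_majority3 (u := u) (v := u) (w := u)) => //.
by move=> a /tP /hu ua; left.
Qed.

Lemma phi_psi_closed D : condorcet D -> closed_condorcet (psi_ (phi_ D)).
Proof. by move=> /phi_condorcet /psi_closed. Qed.

(** Enlarging D weakens phi D and hence enlarges psi (phi D), which is D itself if
    D is closed. *)
Lemma condorcet_closureE D : condorcet D ->
  condorcet_closure Phi Pos D = psi_ (phi_ D).
Proof.
move=> cD; have [DW _ _] := cD; apply/seteqP; split=> w.
  by apply; split; [exact: phi_psi_closed|exact: sub_psi_phi].
move=> [Ww /symmetric_idealsP [tw hw]] C [cC DC].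
rewrite -(psi_phi cC); split=> //; apply/symmetric_idealsP; split=> // a b wb.
move=> [pa pb h]; apply: hw wb _; split=> // v [Dv vb]; split=> //.
by have [] : [set v | C v /\ I_ v a] v by apply: h; split=> //; exact: DC.
Qed.

End RootSystem.

Theorem corollary1p4 (R : realType) (n : nat) (Phi Pos : set 'cV[R]_n)
    (hPhi : root_system Phi) (hPos : positive_roots Phi Pos) :
  [/\ [set D | closed_condorcet_domain Phi Pos D] =
        psi Phi Pos @` [set P | condorcet_root_poset Phi P],
      [/\ set_bij [set D | closed_condorcet_domain Phi Pos D]
            [set P | condorcet_root_poset Phi P] (phi Phi Pos),
          forall D, closed_condorcet_domain Phi Pos D ->
            psi Phi Pos (phi Phi Pos D) = D &
          forall P, condorcet_root_poset Phi P ->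
            phi Phi Pos (psi Phi Pos P) = P] &
      forall D1 D2, condorcet_domain Phi Pos D1 -> condorcet_domain Phi Pos D2 ->
        phi Phi Pos D1 = phi Phi Pos D2 <->
        condorcet_closure Phi Pos D1 = condorcet_closure Phi Pos D2].
Proof.
have phiP D : condorcet_domain Phi Pos D ->
    condorcet_root_poset Phi (phi Phi Pos D).
  exact: phi_condorcet.
have psiP P : condorcet_root_poset Phi P ->
    closed_condorcet_domain Phi Pos (psi Phi Pos P).
  exact: psi_closed.
have psiK D : closed_condorcet_domain Phi Pos D ->
    psi Phi Pos (phi Phi Pos D) = D.
  exact: psi_phi.
have phiK P : condorcet_root_poset Phi P -> phi Phi Pos (psi Phi Pos P) = P.
  exact: phi_psi.
split.
- apply/seteqP; split=> [D cD|_ [P hP <-]]; last exact: psiP.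
  by exists (phi Phi Pos D); [case: cD => /phiP|exact: psiK].
- split=> //; split=> [D [/phiP //]|D1 D2 /set_mem c1 /set_mem c2 e|P hP].
    by rewrite -(psiK _ c1) e psiK.
  by exists (psi Phi Pos P); [exact: psiP|exact: phiK].
move=> D1 D2 c1 c2; rewrite !condorcet_closureE //; split=> [-> //|e].
by rewrite -(phiK _ (phiP _ c1)) e phiK //; exact: phiP.
Qed.
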